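(* Let $(V_1, V_2)$ be an irreducible isometric pair on a Hilbert space $\mathcal{H}$. Then $(V_1, V_2)$ is a $1$-finite pair if and only if $(V_1, V_2)$ is unitarily equivalent to $(M_z, M_w)$ on $H^2(\mathbb{D}^2)$.
   Context: All Hilbert spaces are complex and separable. An isometric pair is a pair $(V_1,V_2)$ of commuting isometries. An isometry $V$ is a shift if $V^{*m}\to0$ strongly. A BCL pair is an isometric pair with $V_1V_2$ a shift. $[V_2^*,V_1] := V_2^*V_1 - V_1V_2^*$. A compact normal pair is a BCL pair with $[V_2^*,V_1]$ compact and normal. $C(V_1,V_2) := I - V_1V_1^* - V_2V_2^* + V_1V_2V_1^*V_2^*$. A $1$-finite pair is a compact normal pair with $\operatorname{rank} C(V_1,V_2)=1$. Irreducible: no closed subspace other than $\{0\}$ and $\mathcal{H}$ invariant under $V_1,V_2,V_1^*,V_2^*$. $H^2(\mathbb{D}^2)$ is the Hardy space of the bidisc and $M_z,M_w$ are multiplication by the coordinate functions. Unitary equivalence of pairs means a single unitary intertwining both components. *)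

(* Defs.v *)
From HB Require Import structures.
From mathcomp Require Import all_boot all_order all_algebra.
From mathcomp Require Import all_classical all_reals.
From mathcomp Require Import topology normedtype sequences esum.
From mathcomp Require Import complex.

Set Implicit Arguments.
Unset Strict Implicit.
Unset Printing Implicit Defensive.

Import Order.TTheory GRing.Theory Num.Theory.
Local Open Scope ring_scope.
Local Open Scope classical_set_scope.

Record inner_product (R : realType) (H : lmodType R[i]) := InnerProduct {
  ip : H -> H -> R[i];
  ip_linear : forall (a : R[i]) (x y z : H),
      ip (a *: x + y) z = a * ip x z + ip y z;
  ip_conj : forall x y : H, ip y x = conjc (ip x y);
  ip_pos : forall x : H, complex.Im (ip x x) = 0 /\ 0 <= complex.Re (ip x x);
  ip_def : forall x : H, ip x x = 0 -> x = 0
}.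

Definition hnorm (R : realType) (H : lmodType R[i]) (P : inner_product H)
  (x : H) : R := Num.sqrt (complex.Re (ip P x x)).

Definition hcvg (R : realType) (H : lmodType R[i]) (P : inner_product H)
  (u : nat -> H) (l : H) : Prop :=
  forall e : R, 0 < e -> exists N : nat, forall n : nat, (N <= n)%N ->
    hnorm P (u n - l) < e.

Definition hcauchy (R : realType) (H : lmodType R[i]) (P : inner_product H)
  (u : nat -> H) : Prop :=
  forall e : R, 0 < e -> exists N : nat, forall n m : nat,
    (N <= n)%N -> (N <= m)%N -> hnorm P (u n - u m) < e.

Record hilbert (R : realType) (H : lmodType R[i]) := Hilbert {
  hip :> inner_product H;
  hcomplete : forall u : nat -> H, hcauchy hip u -> exists l : H, hcvg hip u l;
  hseparable : exists d : nat -> H, forall (x : H) (e : R), 0 < e ->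
      exists n : nat, hnorm hip (x - d n) < e
}.

Definition lin_op (R : realType) (H : lmodType R[i]) (T : H -> H) : Prop :=
  forall (a : R[i]) (x y : H), T (a *: x + y) = a *: T x + T y.

Definition bounded_op (R : realType) (H : lmodType R[i]) (P : inner_product H)
  (T : H -> H) : Prop :=
  lin_op T /\ exists M : R, forall x : H, hnorm P (T x) <= M * hnorm P x.

(* The adjoint T^* : the unique operator with <T x, y> = <x, T^* y>
   (it exists for bounded T by the Riesz representation theorem). *)
Definition adj (R : realType) (H : lmodType R[i]) (P : inner_product H)
  (T : H -> H) : H -> H :=
  fun y => xget 0 [set z : H | forall x : H, ip P (T x) y = ip P x z].

Definition isometry (R : realType) (H : lmodType R[i]) (P : inner_product H)
  (V : H -> H) : Prop :=
  lin_op V /\ forall x : H, hnorm P (V x) = hnorm P x.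

Definition is_shift (R : realType) (H : lmodType R[i]) (P : inner_product H)
  (V : H -> H) : Prop :=
  forall x : H, hcvg P (fun m => iter m (adj P V) x) 0.

Definition compact_op (R : realType) (H : lmodType R[i]) (P : inner_product H)
  (T : H -> H) : Prop :=
  bounded_op P T /\
  forall u : nat -> H, (exists M : R, forall n, hnorm P (u n) <= M) ->
    exists (phi : nat -> nat) (l : H),
      (forall n, (phi n < phi n.+1)%N) /\ hcvg P (fun n => T (u (phi n))) l.

Definition normal_op (R : realType) (H : lmodType R[i]) (P : inner_product H)
  (T : H -> H) : Prop :=
  forall x : H, T (adj P T x) = adj P T (T x).

Definition rank_one (R : realType) (H : lmodType R[i]) (T : H -> H) : Prop :=
  exists v : H, v != 0 /\ (exists x, T x = v) /\
    forall x : H, exists a : R[i], T x = a *: v.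

Definition isometric_pair (R : realType) (H : lmodType R[i]) (P : inner_product H)
  (V1 V2 : H -> H) : Prop :=
  isometry P V1 /\ isometry P V2 /\ forall x, V1 (V2 x) = V2 (V1 x).

Definition BCL_pair (R : realType) (H : lmodType R[i]) (P : inner_product H)
  (V1 V2 : H -> H) : Prop :=
  isometric_pair P V1 V2 /\ is_shift P (V1 \o V2).

Definition cross_comm (R : realType) (H : lmodType R[i]) (P : inner_product H)
  (V1 V2 : H -> H) : H -> H :=
  fun x => adj P V2 (V1 x) - V1 (adj P V2 x).

Definition compact_normal_pair (R : realType) (H : lmodType R[i])
  (P : inner_product H) (V1 V2 : H -> H) : Prop :=
  BCL_pair P V1 V2 /\ compact_op P (cross_comm P V1 V2)
  /\ normal_op P (cross_comm P V1 V2).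

Definition defect_op (R : realType) (H : lmodType R[i]) (P : inner_product H)
  (V1 V2 : H -> H) : H -> H :=
  fun x => x - V1 (adj P V1 x) - V2 (adj P V2 x)
             + V1 (V2 (adj P V1 (adj P V2 x))).

Definition one_finite_pair (R : realType) (H : lmodType R[i])
  (P : inner_product H) (V1 V2 : H -> H) : Prop :=
  compact_normal_pair P V1 V2 /\ rank_one (defect_op P V1 V2).

Definition closed_subspace (R : realType) (H : lmodType R[i]) (P : inner_product H)
  (S : set H) : Prop :=
  S 0 /\ (forall (a : R[i]) x y, S x -> S y -> S (a *: x + y)) /\
  (forall (u : nat -> H) l, (forall n, S (u n)) -> hcvg P u l -> S l).

Definition irreducible_pair (R : realType) (H : lmodType R[i])
  (P : inner_product H) (V1 V2 : H -> H) : Prop :=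
  forall S : set H, closed_subspace P S ->
    (forall x, S x -> S (V1 x) /\ S (V2 x) /\ S (adj P V1 x) /\ S (adj P V2 x)) ->
    S = [set 0] \/ S = [set: H].

(* The Hardy space H^2(D^2), described through Taylor coefficients:   *)
(* f(z,w) = sum_{m,n} a m n z^m w^n  with  ||f||^2 = sum |a m n|^2 .  *)
(* M_z, M_w act on coefficients by shifting the first/second index.   *)

Definition H2_norm2 (R : realType) (a : nat -> nat -> R[i]) : \bar R :=
  \esum_(i in [set: nat * nat])
     (complex.Re (a i.1 i.2 * conjc (a i.1 i.2)))%:E.

Definition in_H2 (R : realType) (a : nat -> nat -> R[i]) : Prop :=
  (H2_norm2 a < +oo)%E.

Definition Mz (R : realType) (a : nat -> nat -> R[i]) : nat -> nat -> R[i] :=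
  fun m n => if m is m'.+1 then a m' n else 0.

Definition Mw (R : realType) (a : nat -> nat -> R[i]) : nat -> nat -> R[i] :=
  fun m n => if n is n'.+1 then a m n' else 0.

Definition unitarily_equiv_Hardy (R : realType) (H : lmodType R[i])
  (P : inner_product H) (V1 V2 : H -> H) : Prop :=
  exists U : H -> nat -> nat -> R[i],
    (forall (c : R[i]) x y m n, U (c *: x + y) m n = c * U x m n + U y m n) /\
    (forall x, H2_norm2 (U x) = ((hnorm P x) ^+ 2)%:E) /\
    (forall a, in_H2 a -> exists x, U x = a) /\
    (forall x, U (V1 x) = Mz (U x)) /\
    (forall x, U (V2 x) = Mw (U x)).

(* Main.v *)
Require Import Defs.
From HB Require Import structures.
From mathcomp Require Import all_boot all_order all_algebra.
From mathcomp Require Import all_classical all_reals.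
From mathcomp Require Import ereal topology normedtype sequences esum.
From mathcomp Require Import complex ring lra.

(* Let E = V2^* V1 - V1 V2^* and let C be the defect operator.  For any
   isometric pair E V2 = 0 and E^* V1 = 0; if E is normal, E and E^* have the
   same kernel, so ran E lies in ker V1^* /\ ker V2^*.  If E <> 0 this gives a
   nonzero v in that intersection, and if E = 0 the range of C lies in it.  Now
   C v = v, so a C of rank one is the projection onto C v, which forces
   V1^* V2 = V2 V1^*.  Hence the vectors V1^m V2^n v are orthogonal and their
   common orthogonal complement is reducing, thus zero, and taking coefficients
   along them identifies the pair with (M_z, M_w).  Conversely, on the Hardy
   space E = 0 and C is the projection onto the constants. *)

Set Implicit Arguments.
Unset Strict Implicit.
Unset Printing Implicit Defensive.

Import Order.TTheory GRing.Theory Num.Theory.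
Local Open Scope ring_scope.
Local Open Scope complex_scope.

(* [sesquilinear] has an [isometry] too. *)
Local Notation isometry := Defs.isometry.

(** * Real inner product, Cauchy-Schwarz, limits of inner products *)

Section InnerProduct.
Variables (R : realType) (H : lmodType R[i]) (P : inner_product H).
Implicit Types (x y z : H) (c : R[i]) (t : R).

Lemma ipDl x y z : ip P (x + y) z = ip P x z + ip P y z.
Proof. by rewrite -{1}(scale1r x) ip_linear mul1r. Qed.

Lemma ip0l y : ip P 0 y = 0.
Proof. by apply: (@addrI _ (ip P 0 y)); rewrite -ipDl !addr0. Qed.

Lemma ipZl c x y : ip P (c *: x) y = c * ip P x y.
Proof. by rewrite -[c *: x]addr0 ip_linear ip0l addr0. Qed.

Lemma ipNl x y : ip P (- x) y = - ip P x y.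
Proof. by rewrite -scaleN1r ipZl mulN1r. Qed.

Lemma ipBl x y z : ip P (x - y) z = ip P x z - ip P y z.
Proof. by rewrite ipDl ipNl. Qed.

Lemma ipDr x y z : ip P x (y + z) = ip P x y + ip P x z.
Proof. by rewrite ip_conj ipDl rmorphD /= -!(ip_conj P). Qed.

Lemma ip0r x : ip P x 0 = 0.
Proof. by rewrite ip_conj ip0l rmorph0. Qed.

Lemma ipZr c x y : ip P x (c *: y) = conjc c * ip P x y.
Proof. by rewrite ip_conj ipZl rmorphM /= -(ip_conj P). Qed.

Lemma ipNr x y : ip P x (- y) = - ip P x y.
Proof. by rewrite ip_conj ipNl rmorphN /= -(ip_conj P). Qed.

Lemma ipBr x y z : ip P x (y - z) = ip P x y - ip P x z.
Proof. by rewrite ipDr ipNr. Qed.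

Lemma ip_suml (I : Type) (r : seq I) (p : pred I) (F : I -> H) y :
  ip P (\sum_(i <- r | p i) F i) y = \sum_(i <- r | p i) ip P (F i) y.
Proof.
by apply: (big_morph (fun x => ip P x y)); [move=> a b; exact: ipDl|exact: ip0l].
Qed.

Lemma ip_injr y z : (forall x, ip P x y = ip P x z) -> y = z.
Proof.
move=> e; apply/eqP; rewrite -subr_eq0; apply/eqP/(ip_def (i := P)).
by rewrite ipBr e subrr.
Qed.

Lemma ip_injl y z : (forall x, ip P y x = ip P z x) -> y = z.
Proof. by move=> e; apply: ip_injr => x; rewrite ip_conj e -ip_conj. Qed.

(** Estimates are carried out with this real inner product, in the ordered field [R]; [ip_Re_Im]
    recovers the complex value from it. *)
Definition rip x y : R := complex.Re (ip P x y).

Lemma cReD (a b : R[i]) : complex.Re (a + b) = complex.Re a + complex.Re b.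
Proof. by case: a b => ? ? []. Qed.

Lemma cReN (a : R[i]) : complex.Re (- a) = - complex.Re a.
Proof. by case: a. Qed.

Lemma cReMr t (a : R[i]) : complex.Re (t%:C * a) = t * complex.Re a.
Proof. by case: a => ? ? /=; rewrite mul0r subr0. Qed.

Lemma ripC x y : rip x y = rip y x.
Proof. by rewrite /rip [ip P y x]ip_conj; case: (ip P x y). Qed.

Lemma ripDl x y z : rip (x + y) z = rip x z + rip y z.
Proof. by rewrite /rip ipDl cReD. Qed.

Lemma ripDr x y z : rip z (x + y) = rip z x + rip z y.
Proof. by rewrite !(ripC z) ripDl. Qed.

Lemma ripNl x y : rip (- x) y = - rip x y.
Proof. by rewrite /rip ipNl cReN. Qed.

Lemma ripNr x y : rip x (- y) = - rip x y.
Proof. by rewrite !(ripC x) ripNl. Qed.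

Lemma ripZl t x y : rip (t%:C *: x) y = t * rip x y.
Proof. by rewrite /rip ipZl cReMr. Qed.

Lemma ripZr t x y : rip x (t%:C *: y) = t * rip x y.
Proof. by rewrite !(ripC x) ripZl. Qed.

Definition ripE := (ripDl, ripDr, ripNl, ripNr, ripZl, ripZr).

Lemma rip_ge0 x : 0 <= rip x x.
Proof. by have [] := ip_pos P x. Qed.

Lemma rip_subC x y : rip (x - y) (x - y) = rip (y - x) (y - x).
Proof. by rewrite -(opprB y) ripNl ripNr opprK. Qed.

Lemma ip_self x : ip P x x = (rip x x)%:C.
Proof. by rewrite /rip; have [] := ip_pos P x; case: (ip P x x) => a b /= ->. Qed.

Lemma hnorm2 x : hnorm P x ^+ 2 = rip x x.
Proof. by rewrite sqr_sqrtr// rip_ge0. Qed.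

Lemma hnorm_ge0 x : 0 <= hnorm P x.
Proof. exact: sqrtr_ge0. Qed.

Lemma rip_eq0 x : rip x x = 0 -> x = 0.
Proof. by move=> e; apply: (ip_def (i := P)); rewrite ip_self e. Qed.

Lemma hnorm0 : hnorm P 0 = 0.
Proof. by rewrite /hnorm ip0l sqrtr0. Qed.

Lemma hnorm_lt x (e : R) : 0 < e -> (hnorm P x < e) = (rip x x < e ^+ 2).
Proof.
by move=> e0; rewrite -hnorm2 ltr_pXn2r ?nnegrE ?hnorm_ge0// ltW.
Qed.

Lemma ip_Re_Im x y : ip P x y = rip x y +i* - rip ('i *: x) y.
Proof. by rewrite /rip ipZl; case: (ip P x y) => a b /=; rewrite mul0r mul1r sub0r opprK. Qed.

Lemma rip_CS x y : `|rip x y| <= hnorm P x * hnorm P y.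
Proof.
rewrite -(@ler_pXn2r _ 2)// ?nnegrE ?mulr_ge0 ?hnorm_ge0//.
rewrite exprMn !hnorm2 real_normK ?num_real//.
have [y0|yN0] := eqVneq (rip y y) 0.
  by rewrite (rip_eq0 y0) ripC [rip 0 _]/rip ip0l expr0n/= mulr_ge0 ?rip_ge0.
have yp : 0 < rip y y by rewrite lt_neqAle eq_sym yN0 rip_ge0.
(* The vector is the residual of projecting [x] onto [y]. *)
have := rip_ge0 (x - (rip x y / rip y y)%:C *: y).
rewrite !ripE (ripC y x) => h.
have : 0 <= rip x x - rip x y ^+ 2 / rip y y.
  suff -> : rip x x - rip x y ^+ 2 / rip y y =
    rip x x + - (rip x y / rip y y * rip x y) + (- (rip x y / rip y y * rip x y) +
      - - (rip x y / rip y y * (rip x y / rip y y * rip y y))) :> R by lra.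
  by field.
by rewrite subr_ge0 ler_pdivrMr.
Qed.

Lemma hcvg_rip (u : nat -> H) l y (e : R) : hcvg P u l -> 0 < e ->
  exists N, forall n, (N <= n)%N -> `|rip (u n) y - rip l y| < e.
Proof.
(* The [+ 1] keeps the divisor positive when [y = 0]. *)
move=> ul e0; have p : 0 < hnorm P y + 1 by have := hnorm_ge0 y; lra.
have [N hN] := ul (e / (hnorm P y + 1)) (divr_gt0 e0 p).
exists N => n /hN; rewrite ltr_pdivlMr// => h.
rewrite -ripNl -ripDl; apply: le_lt_trans (rip_CS _ _) _.
by have := hnorm_ge0 (u n - l); nra.
Qed.

(** This lets Fourier coefficients and orthogonality relations pass to limits. Real and imaginary
    parts are both limits of [rip] against a fixed vector. *)
Lemma hcvg_ip (u : nat -> H) l y c N : hcvg P u l ->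
  (forall n, (N <= n)%N -> ip P (u n) y = c) -> ip P l y = c.
Proof.
move=> ul uc.
have key z (t : R) : (forall n, (N <= n)%N -> rip (u n) z = t) -> rip l z = t.
  move=> ut; apply/eqP; rewrite eq_sym -subr_eq0 -normr_le0 leNgt.
  apply/negP => /(hcvg_rip z ul)[M /(_ (maxn N M))].
  by rewrite leq_maxr ut ?leq_maxl// ltxx => /(_ isT).
have iE x : rip ('i *: x) y = rip x ((- 'i) *: y).
  by rewrite /rip ipZl ipZr rmorphN/=; congr (complex.Re (_ * _)); simpc.
case: c uc => a b uc; rewrite ip_Re_Im iE; congr (_ +i* _).
  by apply: key => n /uc; rewrite /rip => ->.
apply/oppr_inj; rewrite opprK; apply: key => n /uc; rewrite -iE ip_Re_Im => -[_ <-].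
by rewrite opprK.
Qed.

End InnerProduct.

(** * Riesz representation *)

Lemma invS_lt (R : realType) (e : R) : 0 < e -> exists N, forall n,
  (N <= n)%N -> n.+1%:R^-1 < e.
Proof.
move=> /ltr_add_invr[N]; rewrite add0r => hN; exists N => n Nn.
by apply: le_lt_trans hN; rewrite lef_pV2 ?posrE ?ltr0n// ler_nat ltnS.
Qed.

(* The representing vector minimizes [|x|^2 - 2 Re (f x)]; the parallelogram law
   makes minimizing sequences Cauchy. *)
Lemma riesz (R : realType) (H : lmodType R[i]) (P : hilbert H) (f : H -> R[i])
    (M : R) :
  (forall (a : R[i]) (x y : H), f (a *: x + y) = a * f x + f y) ->
  (forall x, `|complex.Re (f x)| <= M * hnorm P x) ->
  exists z, forall x, f x = ip P x z.
Proof.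
move=> flin fM; pose g x := complex.Re (f x).
have gDZ (t : R) (x y : H) : g (t%:C *: x + y) = t * g x + g y.
  by rewrite /g flin cReD cReMr.
have g0 : g 0 = 0.
  by have := gDZ 1 0 0; rewrite scaler0 addr0 mul1r; lra.
pose Phi x := rip P x x - 2 * g x.
(* Completing the square: [|x|^2 - 2 M |x| >= - M^2]. *)
have Phi_lb x : - M ^+ 2 <= Phi x.
  have := fM x; rewrite -/(g x) /Phi -hnorm2 ler_norml => /andP[_ h].
  by have := sqr_ge0 (hnorm P x - M); nra.
pose E := [set Phi x | x in [set: H]]%classic.
have infE : has_inf E.
  split; first by exists (Phi 0); exists 0.
  by exists (- M ^+ 2) => _ [x _ <-].
pose d := inf E.
have d_le x : d <= Phi x by apply: ge_inf; [case: infE|exists x].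
have /choice[u uP] : forall n : nat, exists x, Phi x < d + n.+1%:R^-1.
  move=> n; have n0 : 0 < n.+1%:R^-1 :> R by rewrite invr_gt0 ltr0n.
  by have [_ [x _ <-] h] := inf_adherent n0 infE; exists x.
have ucauchy : hcauchy P u.
  move=> e e0; have e4 : 0 < e ^+ 2 / 4 by rewrite divr_gt0// exprn_gt0.
  have [N hN] := invS_lt e4; exists N => n m /hN hn /hN hm.
  rewrite hnorm_lt//.
  (* At the midpoint [Phi] is at least [d], so the parallelogram law bounds [|u n - u m|^2] by twice
     the sum of the two excesses over [d], each below [e^2 / 4]. *)
  have := d_le ((2^-1)%:C *: u n + ((2^-1)%:C *: u m + 0)).
  rewrite /Phi !gDZ g0 !addr0 !ripE (ripC P (u m) (u n)).
  have := uP n; have := uP m; rewrite /Phi; move: hn hm.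
  by move: (n.+1%:R^-1) (m.+1%:R^-1) => p q; lra.
have [z uz] := hcomplete ucauchy.
(* Moving [u n] along [h] cannot take [Phi] below [d], so the directional derivative at [u n] is
   small. *)
have near_crit n h : (rip P (u n) h - g h) ^+ 2 <= n.+1%:R^-1 * (rip P h h + 1).
  set B := rip P (u n) h - g h; set A := rip P h h.
  have A0 : 0 <= A by exact: rip_ge0.
  have A1 : 0 < A + 1 by lra.
  (* Close to the minimizer [- B / A] of the quadratic in [t]; [A + 1] avoids dividing by zero when
     [h = 0]. *)
  set t := - (B / (A + 1)).
  have tA : t * (A + 1) = - B by rewrite /t mulNr divfK// gt_eqF.
  have := d_le (t%:C *: h + u n); have := uP n.
  rewrite /Phi gDZ !ripE (ripC P h (u n)) -/A.
  move: (n.+1%:R^-1) => q h1 h2.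
  have {h1 h2} : 0 < t * (t * A) + 2 * (t * B) + q by rewrite /B; lra.
  have -> : B = - (t * (A + 1)) by rewrite tA opprK.
  move=> h0; have t0 := sqr_ge0 t.
  have : t ^+ 2 * (A + 1) <= q by lra.
  by move=> /(ler_wpM2r (ltW A1)); lra.
have gz h : g h = rip P h z.
  apply/eqP; rewrite ripC -subr_eq0 -normr_le0 leNgt; apply/negP.
  set D := `|_| => D0.
  have A1 : 0 < rip P h h + 1 by have := rip_ge0 P h; lra.
  have D2 : 0 < D / 2 by lra.
  have D4 : 0 < D ^+ 2 / 4 / (rip P h h + 1) by rewrite !divr_gt0// exprn_gt0.
  have [N1 h1] := hcvg_rip h uz D2; have [N2 h2] := invS_lt D4.
  move: (h1 _ (leq_maxl N1 N2)) (h2 _ (leq_maxr N1 N2)) => {}h1 {}h2.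
  have := near_crit (maxn N1 N2) h; move: h1 h2; set n := maxn _ _.
  rewrite (ltr_pdivlMr _ _ A1) => h1 h2 h3.
  have h4 := le_lt_trans h3 h2.
  have h5 : `|rip P (u n) h - g h| < D / 2.
    rewrite -(@ltr_pXn2r _ 2)// ?nnegrE ?normr_ge0 ?ltW// real_normK ?num_real//.
    by rewrite expr_div_n; lra.
  have : D <= `|rip P (u n) h - rip P z h| + `|rip P (u n) h - g h|.
    rewrite (distrC _ (g h)) addrC /D.
    by apply: le_trans (ler_normD _ _); rewrite subrKA.
  by lra.
exists z => x; rewrite ip_Re_Im -!gz /g.
have := flin 'i x 0; rewrite addr0 => ->.
have -> : f 0 = 0.
  by have := flin 1 0 0; rewrite scaler0 addr0 mul1r -{1}[f 0]addr0 => /addrI.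
by rewrite addr0; case: (f x) => a b /=; rewrite mul0r mul1r sub0r opprK.
Qed.

(** * Adjoints of isometries *)

Section Adjoint.
Variables (R : realType) (H : lmodType R[i]).

Lemma adj_eq (P : inner_product H) (T S : H -> H) :
  (forall x y, ip P (T x) y = ip P x (S y)) -> adj P T = S.
Proof.
move=> TS; apply/funext => y; rewrite /adj; case: xgetP => [z _ /= hz|/(_ (S y))].
  by apply: (@ip_injr _ _ P) => x; rewrite -hz TS.
by case=> x; exact: TS.
Qed.

(** Real polarization: expand the squared norm of the image of [x + y]. *)
Lemma isometry_rip (P : inner_product H) (V : H -> H) x y :
  isometry P V -> rip P (V x) (V y) = rip P x y.
Proof.
move=> [Vlin Viso]; have := hnorm2 P (V (1 *: x + y)).
rewrite Viso hnorm2 Vlin !scale1r !ripE -!(hnorm2 P (V _)) !Viso !hnorm2.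
by rewrite (ripC P y) (ripC P (V y)); lra.
Qed.

Lemma isometry_ip (P : inner_product H) (V : H -> H) x y :
  isometry P V -> ip P (V x) (V y) = ip P x y.
Proof.
move=> Viso; have [Vlin _] := Viso; rewrite !ip_Re_Im isometry_rip//.
have V0 : V 0 = 0.
  by apply: (@addrI _ (V 0)); rewrite -{1}(scale1r (V 0)) -Vlin scaler0 !addr0.
have := Vlin 'i x 0; rewrite V0 !addr0 => <-.
by rewrite isometry_rip.
Qed.

Lemma isometry_comp (P : inner_product H) (V W : H -> H) :
  isometry P V -> isometry P W -> isometry P (V \o W).
Proof.
by move=> [Vl Vn] [Wl Wn]; split=> [a x y|x] /=; rewrite ?Wl ?Vl// Vn Wn.
Qed.

(** Riesz supplies a representing vector, so [adj] does not fall back on its default value [0]. *)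
Lemma isometry_adjP (P : hilbert H) (V : H -> H) x y :
  isometry P V -> ip P (V x) y = ip P x (adj P V y).
Proof.
move=> [Vlin Vn].
have [a u v|a|z hz] := @riesz _ _ P (fun x => ip P (V x) y) (hnorm P y).
- by rewrite Vlin ip_linear.
- by rewrite mulrC -(Vn a); exact: rip_CS.
by rewrite /adj; case: xgetP => [w _ /= <-//|/(_ z)].
Qed.

Lemma isometry_adjK (P : hilbert H) (V : H -> H) :
  isometry P V -> cancel V (adj P V).
Proof.
move=> Vi x; apply: (@ip_injr _ _ P) => y.
by rewrite -isometry_adjP// isometry_ip.
Qed.

End Adjoint.

(** The squared modulus, in a form convertible to the summands of [H2_norm2]. *)
Definition sqnorm (R : realType) (c : R[i]) : R := complex.Re (c * conjc c).

Lemma sqnorm_ge0 (R : realType) (c : R[i]) : 0 <= sqnorm c.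
Proof. by case: c => a b; rewrite /sqnorm /=; nra. Qed.

Lemma sum_nat_sub (V : zmodType) (F : nat -> V) M N : (M <= N)%N ->
  \sum_(0 <= n < N) F n - \sum_(0 <= n < M) F n = \sum_(M <= n < N) F n.
Proof. by move=> MN; rewrite (big_cat_nat (n := M))//= addrAC subrr add0r. Qed.

(** * Orthonormal sequences: Bessel and Riesz-Fischer *)

Section Orthonormal.
Variables (R : realType) (H : lmodType R[i]) (P : hilbert H).
Variables (g : nat -> H) (a : nat -> R[i]).
Hypothesis g_on : forall m n, ip P (g m) (g n) = (m == n)%:R.

Let s M N : H := \sum_(M <= n < N) a n *: g n.

Lemma ip_partial_sum M N n :
  ip P (s M N) (g n) = if (M <= n < N)%N then a n else 0.
Proof.
rewrite /s ip_suml -(big_nat1_eq +%R a) [RHS]big_mkcond; apply: eq_bigr => i _ /=.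
by rewrite ipZl g_on; case: eqP => _; rewrite ?mulr1 ?mulr0.
Qed.

Lemma rip_partial_sum M N :
  rip P (s M N) (s M N) = \sum_(M <= n < N) sqnorm (a n).
Proof.
rewrite /rip {1}/s ip_suml (big_morph _ (@cReD R) erefl).
apply: eq_big_nat => i iMN; rewrite ipZl [ip P (g i) _]ip_conj.
by rewrite ip_partial_sum iMN.
Qed.

Lemma rip_residual x N : (forall n, ip P x (g n) = a n) ->
  rip P (x - s 0 N) (x - s 0 N) = rip P x x - \sum_(0 <= n < N) sqnorm (a n).
Proof.
move=> xa; have xs : rip P x (s 0 N) = \sum_(0 <= n < N) sqnorm (a n).
  rewrite ripC /rip {1}/s ip_suml (big_morph _ (@cReD R) erefl).
  by apply: eq_bigr => i _; rewrite ipZl [ip P (g i) _]ip_conj xa.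
by rewrite !ripE (ripC P (s 0 N) x) xs rip_partial_sum; lra.
Qed.

Lemma bessel_nat x N : (forall n, ip P x (g n) = a n) ->
  \sum_(0 <= n < N) sqnorm (a n) <= hnorm P x ^+ 2.
Proof.
by move=> xa; rewrite hnorm2 -subr_ge0 -rip_residual// rip_ge0.
Qed.

(** Squared distances between partial sums of [a n *: g n] are increments of a bounded nondecreasing
    real sequence, so the partial sums converge. The second clause is the half of Parseval that
    Bessel does not give. *)
Lemma riesz_fischer_nat (B : R) :
  (forall N, \sum_(0 <= n < N) sqnorm (a n) <= B) ->
  exists2 x, (forall n, ip P x (g n) = a n) &
    forall e, 0 < e -> exists N,
      hnorm P x ^+ 2 - e < \sum_(0 <= n < N) sqnorm (a n).
Proof.
move=> sB; pose b N := \sum_(0 <= n < N) sqnorm (a n).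
have bS M N : (M <= N)%N -> rip P (s 0 N - s 0 M) (s 0 N - s 0 M) = b N - b M.
  by move=> MN; rewrite /s /b !sum_nat_sub// rip_partial_sum.
pose E := range b.
have supE : has_sup E.
  by split; [exists (b 0); exists 0%N|exists B => _ [N _ <-]; exact: sB].
have b_le N : b N <= sup E by apply: ub_le_sup; [case: supE|exists N].
have scauchy : hcauchy P (s 0).
  move=> e e0; have e2 : 0 < e ^+ 2 by rewrite exprn_gt0.
  have [_ [N _ <-] hN] := sup_adherent e2 supE.
  exists N => n m Nn Nm; rewrite hnorm_lt//.
  wlog nm : n m Nn Nm / (m <= n)%N => [wl|].
    have [/wl|/ltnW/wl] := leqP m n; first exact.
    by rewrite rip_subC; exact.
  rewrite bS//; have := b_le n.
  have : b N <= b m by rewrite -subr_ge0 -bS// rip_ge0.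
  by lra.
have [x sx] := hcomplete scauchy.
have xa n : ip P x (g n) = a n.
  apply: (hcvg_ip (N := n.+1)) sx _ => N nN.
  by rewrite ip_partial_sum leq0n nN.
exists x => // e e0.
(* The residual has squared norm [|x|^2] minus the partial sum, hence the tolerance [Num.sqrt e]. *)
have se0 : 0 < Num.sqrt e by rewrite sqrtr_gt0.
have [N /(_ N (leqnn N))] := sx _ se0; rewrite hnorm_lt// sqr_sqrtr ?ltW//.
rewrite rip_subC rip_residual// -hnorm2 => h.
by exists N; lra.
Qed.

End Orthonormal.

(** * Orthonormal families indexed by pairs, and Parseval *)

Section OrthonormalPairs.
Variables (R : realType) (H : lmodType R[i]) (P : hilbert H).
Variable g : nat * nat -> H.
Hypothesis g_on : forall i j, ip P (g i) (g j) = (i == j)%:R.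

(** Enumerating the pairs turns the unordered sum into a series, to which the results on sequences
    apply. *)
Lemma esum_enum : exists2 e : nat -> nat * nat, injective e &
  (forall i, exists n, e n = i) /\
  forall F : nat * nat -> R, (forall i, 0 <= F i) ->
    \esum_(i in [set: nat * nat]) (F i)%:E = (\sum_(n <oo) (F (e n))%:E)%E.
Proof.
have /card_set_bijP[e bij_e] : ([set: nat] #= [set: nat * nat])%card.
  by rewrite card_eq_sym; exact: card_nat2.
have [_ inj_e surj_e] := bij_e; exists e.
  by move=> m n; apply: inj_e; rewrite inE.
split=> [i|F F0]; first by have [n _ <-] := surj_e i I; exists n.
rewrite (@reindex_esum _ _ _ _ _ e _ bij_e).
by rewrite nneseries_esumT// => n; rewrite lee_fin.
Qed.

Lemma bessel x :
  (\esum_(i in [set: nat * nat]) (sqnorm (ip P x (g i)))%:E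
    <= (hnorm P x ^+ 2)%:E)%E.
Proof.
have [e inj_e [_ ->]] := esum_enum; last by move=> i; exact: sqnorm_ge0.
apply: lime_le.
  by apply: is_cvg_nneseries => n _ _; rewrite lee_fin sqnorm_ge0.
apply: nearW => N; rewrite sumEFin lee_fin.
by apply: (@bessel_nat _ _ P (g \o e)) => // m n /=; rewrite g_on (inj_eq inj_e).
Qed.

Lemma riesz_fischer (a : nat * nat -> R[i]) :
  (\esum_(i in [set: nat * nat]) (sqnorm (a i))%:E < +oo)%E ->
  exists2 x, (forall i, ip P x (g i) = a i) &
    ((hnorm P x ^+ 2)%:E <= \esum_(i in [set: nat * nat]) (sqnorm (a i))%:E)%E.
Proof.
have [e inj_e [surj_e esumE]] := esum_enum.
rewrite esumE; last by move=> i; exact: sqnorm_ge0.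
set S := (X in (X < +oo)%E) => Soo.
have b0 n : (0 <= (sqnorm (a (e n)))%:E)%E by rewrite lee_fin sqnorm_ge0.
have Sfin : S \is a fin_num by rewrite ge0_fin_numE// nneseries_ge0.
have b_le N : \sum_(0 <= n < N) sqnorm (a (e n)) <= fine S.
  by rewrite -lee_fin fineK// -sumEFin nneseries_lim_ge.
have ge_on m n : ip P (g (e m)) (g (e n)) = (m == n)%:R.
  by rewrite g_on (inj_eq inj_e).
have [x xa xb] := riesz_fischer_nat (a := a \o e) ge_on b_le.
exists x => [i|]; first by have [n <-] := surj_e i; rewrite xa.
rewrite -[X in (_ <= X)%E](fineK Sfin) lee_fin; apply/ler_addgt0Pr => d d0.
by have [N /ltW] := xb _ d0; have := b_le N; rewrite /=; lra.
Qed.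

(** Riesz-Fischer on the coefficients of [x] yields a vector whose squared norm is at most their
    sum; totality identifies it with [x], and Bessel is the other inequality. *)
Lemma parseval x : (forall y, (forall i, ip P y (g i) = 0) -> y = 0) ->
  \esum_(i in [set: nat * nat]) (sqnorm (ip P x (g i)))%:E = (hnorm P x ^+ 2)%:E.
Proof.
move=> g_total; apply/eqP; rewrite eq_le bessel /=.
have [|y yx] := @riesz_fischer (fun i => ip P x (g i)).
  by apply: le_lt_trans (bessel x) _; rewrite ltry.
suff -> : y = x by [].
by apply/eqP; rewrite -subr_eq0; apply/eqP/g_total => i; rewrite ipBl yx subrr.
Qed.

End OrthonormalPairs.

(** * Linear operators and algebraic identities for isometric pairs *)

Section LinOp.
Variables (R : realType) (H : lmodType R[i]) (T : H -> H).
Hypothesis Tlin : lin_op T.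

Lemma lin_opD x y : T (x + y) = T x + T y.
Proof. by rewrite -{1}(scale1r x) Tlin scale1r. Qed.

Lemma lin_op0 : T 0 = 0.
Proof. by apply: (@addrI _ (T 0)); rewrite -lin_opD !addr0. Qed.

Lemma lin_opN x : T (- x) = - T x.
Proof. by apply/eqP; rewrite -addr_eq0 -lin_opD addNr lin_op0. Qed.

Lemma lin_opB x y : T (x - y) = T x - T y.
Proof. by rewrite lin_opD lin_opN. Qed.

End LinOp.

Section IsometricPair.
Variables (R : realType) (H : lmodType R[i]) (P : hilbert H).

Lemma adj_isometryP (V : H -> H) x y :
  isometry P V -> ip P (adj P V x) y = ip P x (V y).
Proof. by move=> Vi; rewrite ip_conj -isometry_adjP// -ip_conj. Qed.

Lemma adj_lin (V : H -> H) : isometry P V -> lin_op (adj P V).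
Proof.
move=> Vi a x y; apply: (@ip_injl _ _ P) => z.
by rewrite ip_linear !adj_isometryP// ip_linear.
Qed.

Lemma isometric_pairC (V1 V2 : H -> H) :
  isometric_pair P V1 V2 -> isometric_pair P V2 V1.
Proof. by case=> V1i [V2i VC]; split=> //; split=> // x; rewrite VC. Qed.

Lemma adj_comp (V W : H -> H) x : isometry P V -> isometry P W ->
  adj P (V \o W) x = adj P W (adj P V x).
Proof.
move=> Vi Wi; apply: (@ip_injl _ _ P) => y.
by rewrite adj_isometryP; [rewrite !adj_isometryP|exact: isometry_comp].
Qed.

Variables V1 V2 : H -> H.
Hypothesis V12 : isometric_pair P V1 V2.

Let V1i : isometry P V1. Proof. by case: V12. Qed.
Let V2i : isometry P V2. Proof. by case: V12 => _ []. Qed.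
Let VC x : V1 (V2 x) = V2 (V1 x). Proof. by case: V12 => _ []. Qed.
Local Notation A1 := (adj P V1).
Local Notation A2 := (adj P V2).
Let V1l : lin_op V1. Proof. by case: V1i. Qed.
Let V2l : lin_op V2. Proof. by case: V2i. Qed.
Let A1l : lin_op A1 := adj_lin V1i.
Let A2l : lin_op A2 := adj_lin V2i.

Lemma adj_commute x : A1 (A2 x) = A2 (A1 x).
Proof. by apply: (@ip_injl _ _ P) => y; rewrite !adj_isometryP// VC. Qed.

Lemma cross_comm_ip x y :
  ip P (cross_comm P V1 V2 x) y = ip P x (cross_comm P V2 V1 y).
Proof.
by rewrite /cross_comm ipBl ipBr adj_isometryP// !(isometry_adjP _ _ V1i) adj_isometryP.
Qed.

Lemma cross_comm_V2 x : cross_comm P V1 V2 (V2 x) = 0.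
Proof. by rewrite /cross_comm VC !(isometry_adjK V2i) subrr. Qed.

(** Together with [adj2_defect], this puts the range of the defect operator in
    [ker V1^* /\ ker V2^*] once both cross-commutators vanish. *)
Lemma adj1_defect x :
  A1 (defect_op P V1 V2 x) = - cross_comm P V2 V1 (A2 x).
Proof.
rewrite /defect_op /cross_comm (lin_opD A1l) !(lin_opB A1l) !(isometry_adjK V1i).
by rewrite subrr sub0r opprB addrC.
Qed.

Lemma adj2_defect x :
  A2 (defect_op P V1 V2 x) = - cross_comm P V1 V2 (A1 x).
Proof.
rewrite /defect_op /cross_comm (lin_opD A2l) !(lin_opB A2l) VC !(isometry_adjK V2i).
by rewrite (addrAC (A2 x)) subrr sub0r opprB addrC adj_commute.
Qed.

Lemma defect_ip x y : ip P (defect_op P V1 V2 x) y = ip P x (defect_op P V1 V2 y).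
Proof.
rewrite /defect_op !(ipDl, ipDr, ipNl, ipNr).
rewrite !(isometry_adjP _ _ V1i) !(isometry_adjP _ _ V2i).
by rewrite !adj_isometryP// -adj_commute !VC.
Qed.

Lemma defect_fix v : A1 v = 0 -> A2 v = 0 -> defect_op P V1 V2 v = v.
Proof.
move=> v1 v2; rewrite /defect_op v1 v2 !(lin_op0 V1l, lin_op0 V2l, lin_op0 A1l).
by rewrite !subr0 addr0.
Qed.

End IsometricPair.

(** * Wandering vector and double commutation for 1-finite pairs *)

Section OneFinite.
Variables (R : realType) (H : lmodType R[i]) (P : hilbert H) (V1 V2 : H -> H).
Hypothesis V12 : isometric_pair P V1 V2.

Let V21 : isometric_pair P V2 V1 := isometric_pairC V12.
Let V1i : isometry P V1. Proof. by case: V12. Qed.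
Let V2i : isometry P V2. Proof. by case: V12 => _ []. Qed.
Local Notation A1 := (adj P V1).
Local Notation A2 := (adj P V2).
Local Notation E := (cross_comm P V1 V2).
Local Notation F := (cross_comm P V2 V1).

Lemma adj_cross_comm : adj P E = F.
Proof. by apply: adj_eq => x y; exact: cross_comm_ip. Qed.

Lemma normal_cross_comm_eq0 x : normal_op P E -> E x = 0 <-> F x = 0.
Proof.
move=> nE.
(* [<E x, E x> = <x, E^* E x> = <x, E E^* x> = <E^* x, E^* x>], with [E^* = F]. *)
have EF : rip P (E x) (E x) = rip P (F x) (F x).
  by rewrite /rip !cross_comm_ip// -adj_cross_comm nE.
have z0 : rip P 0 0 = 0 by rewrite /rip ip0l.
by split=> h; apply: (@rip_eq0 _ _ P); [rewrite -EF h z0|rewrite EF h z0].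
Qed.

(** The range of [E] is orthogonal to that of [V1] because [F V1 = 0], and to that of [V2] because
    normality turns [E V2 = 0] into [F V2 = 0]. *)
Lemma normal_cross_comm_range x :
  normal_op P E -> A1 (E x) = 0 /\ A2 (E x) = 0.
Proof.
move=> nE; split; apply: (@ip_injl _ _ P) => y;
  rewrite adj_isometryP// cross_comm_ip// ip0l.
  by rewrite cross_comm_V2// ip0r.
by rewrite (normal_cross_comm_eq0 _ nE).1 ?ip0r// cross_comm_V2.
Qed.

Lemma wandering_vector : normal_op P E -> rank_one (defect_op P V1 V2) ->
  exists v, [/\ v != 0, A1 v = 0 & A2 v = 0].
Proof.
move=> nE [w [w0 [[x Dx] _]]].
have [[y Ey]|E0] := pselect (exists y, E y <> 0).
  by exists (E y); have [] := normal_cross_comm_range y nE; split => //; exact/eqP.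
have {}E0 y : E y = 0 by apply: contra_notP E0 => Ey; exists y.
have F0 y : F y = 0 by apply/(normal_cross_comm_eq0 y nE).
(* Both commutators vanish, so any nonzero value of the defect operator will do. *)
by exists w; split=> //; rewrite -Dx ?adj1_defect ?adj2_defect// ?E0 ?F0 oppr0.
Qed.

(** The fixed vector [v] spans the range, so the image of [x] is a multiple of [v]; by
    self-adjointness its product with [v] is [<x, v> = 0]. *)
Lemma defect_rank_one_orth v : A1 v = 0 -> A2 v = 0 -> v != 0 ->
  rank_one (defect_op P V1 V2) ->
  forall x, ip P x v = 0 -> defect_op P V1 V2 x = 0.
Proof.
move=> v1 v2 v0 [w [w0 [_ Dw]]] x xv.
have [a Dx] := Dw x; have [b] := Dw v; rewrite defect_fix// => vb.
have b0 : b != 0 by apply: contraNneq v0 => b0; rewrite vb b0 scale0r.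
have Dxv : defect_op P V1 V2 x = (a / b) *: v.
  by rewrite Dx vb scalerA divfK.
have : ip P (defect_op P V1 V2 x) v = 0 by rewrite defect_ip// defect_fix.
rewrite Dxv ipZl => /eqP; rewrite mulf_eq0 => /orP[/eqP ->|].
  by rewrite scale0r.
by move=> /eqP/ip_def v00; rewrite v00 eqxx in v0.
Qed.

(* [V2] maps [ker V1^*] into [v^perp], where the defect operator vanishes; on
   such vectors that operator is [- V1 V1^*]. *)
Lemma doubly_commuting v x : A1 v = 0 -> A2 v = 0 -> v != 0 ->
  rank_one (defect_op P V1 V2) -> A1 (V2 x) = V2 (A1 x).
Proof.
(* [y] is the projection of [x] onto [ker V1^*]; the goal unfolds from [V1^* V2 y = 0]. *)
move=> v1 v2 v0 Dr; set y := x - V1 (A1 x).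
have [[V1l _] [V2l _]] := (V1i, V2i).
have A1y : A1 y = 0.
  by rewrite /y (lin_opB (adj_lin V1i)) (isometry_adjK V1i) subrr.
have : ip P (V2 y) v = 0 by rewrite isometry_adjP// v2 ip0r.
move=> /(defect_rank_one_orth v1 v2 v0 Dr).
rewrite /defect_op (isometry_adjK V2i) A1y (lin_op0 V2l) (lin_op0 V1l) addr0.
rewrite addrAC subrr sub0r => /eqP; rewrite oppr_eq0 -(lin_op0 V1l).
move=> /eqP/(can_inj (isometry_adjK V1i)).
rewrite /y (lin_opB V2l) -V12.2.2 (lin_opB (adj_lin V1i)).
by rewrite (isometry_adjK V1i) => /eqP; rewrite subr_eq0 => /eqP.
Qed.

End OneFinite.

(** * The orthonormal basis generated by a wandering vector *)

Section HardyModel.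
Variables (R : realType) (H : lmodType R[i]) (P : hilbert H) (V1 V2 : H -> H).
Hypothesis V12 : isometric_pair P V1 V2.
Local Notation A1 := (adj P V1).
Local Notation A2 := (adj P V2).
Hypothesis A1V2 : forall x, A1 (V2 x) = V2 (A1 x).
Variable v : H.
Hypotheses (v1 : A1 v = 0) (v2 : A2 v = 0) (vv : ip P v v = 1).

Let V1i : isometry P V1. Proof. by case: V12. Qed.
Let V2i : isometry P V2. Proof. by case: V12 => _ []. Qed.
Let VC x : V1 (V2 x) = V2 (V1 x). Proof. by case: V12 => _ []. Qed.
Let V1l : lin_op V1. Proof. by case: V1i. Qed.
Let V2l : lin_op V2. Proof. by case: V2i. Qed.

Let A2V1 x : A2 (V1 x) = V1 (A2 x).
Proof.
apply: (@ip_injl _ _ P) => y; rewrite adj_isometryP// !(isometry_adjP _ _ V1i).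
by rewrite A1V2 adj_isometryP.
Qed.

Definition wandering_basis (i : nat * nat) : H := iter i.1 V1 (iter i.2 V2 v).
Local Notation e := wandering_basis.

Lemma V1_basis m n : V1 (e (m, n)) = e (m.+1, n).
Proof. by []. Qed.

Lemma V2_basis m n : V2 (e (m, n)) = e (m, n.+1).
Proof. by rewrite /e/=; elim: m => //= m <-. Qed.

(** When [m = 0], double commutation carries [V1^*] through the powers of [V2] down to [v], which it
    kills. *)
Lemma adj1_basis m n : A1 (e (m, n)) = if m is m'.+1 then e (m', n) else 0.
Proof.
case: m => [|m]; last by rewrite -V1_basis (isometry_adjK V1i).
elim: n => [|n IHn]; first exact: v1.
by rewrite -V2_basis A1V2 IHn (lin_op0 V2l).
Qed.

Lemma adj2_basis m n : A2 (e (m, n)) = if n is n'.+1 then e (m, n') else 0.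
Proof.
case: n => [|n]; last by rewrite -V2_basis (isometry_adjK V2i).
elim: m => [|m IHm]; first exact: v2.
by rewrite -V1_basis A2V1 IHm (lin_op0 V1l).
Qed.

Definition coord (x : H) (m n : nat) : R[i] := ip P x (e (m, n)).

Lemma coord_V1 x : coord (V1 x) = Mz (coord x).
Proof.
apply/funext => m; apply/funext => n; rewrite /coord isometry_adjP// adj1_basis.
by case: m => //=; rewrite ip0r.
Qed.

Lemma coord_V2 x : coord (V2 x) = Mw (coord x).
Proof.
apply/funext => m; apply/funext => n; rewrite /coord isometry_adjP// adj2_basis.
by case: n => //=; rewrite ip0r.
Qed.

(** Reading the product as a coordinate of [e i], the shift rules [coord_V1] and [coord_V2] strip
    the powers from [e i]; then [v] is orthogonal to the ranges of [V1] and [V2]. *)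
Lemma basis_orthonormal i j : ip P (e i) (e j) = (i == j)%:R.
Proof.
case: i j => [p q] [m n]; rewrite -[LHS]/(coord (e (p, q)) m n).
elim: p m => [|p IHp] m; last first.
  by rewrite -V1_basis coord_V1; case: m => //= m; rewrite IHp.
elim: q n => [|q IHq] n; last first.
  by rewrite -V2_basis coord_V2; case: n => [|n] /=; rewrite ?IHq// xpair_eqE andbF.
rewrite /coord -[e (0, 0)]/v; case: m => [|m]; last first.
  by rewrite -V1_basis -adj_isometryP// v1 ip0l.
case: n => [|n]; first by rewrite vv.
by rewrite -V2_basis -adj_isometryP// v2 ip0l.
Qed.

(** The orthogonal complement of the basis is closed and reducing, and it is not the whole space
    because [<v, v> = 1]. *)
Lemma basis_total : irreducible_pair P V1 V2 ->
  forall x, (forall i, ip P x (e i) = 0) -> x = 0.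
Proof.
move=> irr; pose S : set H := [set x | forall i, ip P x (e i) = 0]%classic.
have [||S0|ST] := irr S.
- split; [|split] => [i|a x y Sx Sy i|u l Su ul i]; first exact: ip0l.
    by rewrite ip_linear Sx Sy mulr0 addr0.
  by apply: (hcvg_ip (N := 0%N) ul) => n _; exact: Su.
(* [V1] and [V2] shift the coordinates and insert zeros; the adjoints pair [x] with later basis
   vectors. *)
- move=> x Sx; split; [|split; [|split]] => -[m n].
  + rewrite -[LHS]/(coord (V1 x) m n) coord_V1.
    by case: m => //= m; exact: Sx.
  + rewrite -[LHS]/(coord (V2 x) m n) coord_V2.
    by case: n => //= n; exact: Sx.
  + by rewrite adj_isometryP// V1_basis; exact: Sx.
  + by rewrite adj_isometryP// V2_basis; exact: Sx.
- by move=> x Sx; have : S x by []; rewrite S0.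
- have : S v by rewrite ST.
  by move=> /(_ (0, 0)%N) /eqP; rewrite [ip _ _ _]vv oner_eq0.
Qed.

(** The unitary is [coord]: Parseval makes it isometric, Riesz-Fischer makes it onto. *)
Lemma wandering_hardy : irreducible_pair P V1 V2 ->
  unitarily_equiv_Hardy P V1 V2.
Proof.
move=> irr; have total := basis_total irr.
exists coord; split; first by move=> c x y m n; exact: ip_linear.
split; first by move=> x; exact: (parseval basis_orthonormal x total).
split; last by split; [exact: coord_V1|exact: coord_V2].
move=> a aH; have [x xa _] :=
  riesz_fischer (a := fun i => a i.1 i.2) basis_orthonormal aH.
by exists x; apply/funext => m; apply/funext => n; rewrite /coord xa.
Qed.

End HardyModel.

Lemma one_finite_hardy (R : realType) (H : lmodType R[i]) (P : hilbert H)
    (V1 V2 : H -> H) :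
  isometric_pair P V1 V2 -> irreducible_pair P V1 V2 ->
  one_finite_pair P V1 V2 -> unitarily_equiv_Hardy P V1 V2.
Proof.
move=> V12 irr [[_ [_ nE]] Dr].
have [w [w0 w1 w2]] := wandering_vector V12 nE Dr.
have A1V2 x := doubly_commuting V12 x w1 w2 w0 Dr.
have nw : hnorm P w != 0.
  apply: contraNneq w0 => nw; apply/eqP/(@rip_eq0 _ _ P).
  by rewrite -hnorm2 nw expr0n.
(* Normalizes [w], since the model asks for a unit wandering vector. *)
pose c : R[i] := ((hnorm P w)^-1)%:C.
have A0 V : isometry P V -> adj P V w = 0 -> adj P V (c *: w) = 0.
  move=> Vi Aw; have := adj_lin Vi c w 0.
  by rewrite (lin_op0 (adj_lin Vi)) !addr0 Aw scaler0.
have [V1i [V2i _]] := V12.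
apply: (wandering_hardy V12 A1V2 (A0 _ V1i w1) (A0 _ V2i w2)) => //.
rewrite ip_self ripZl ripZr -hnorm2 expr2 mulrA mulrA -mulrA.
by congr (_%:C); field.
Qed.

(** * Coefficient arrays: monomials and tails *)

Lemma subset_esum (R : realType) (T : choiceType) (A B : set T)
    (F : T -> \bar R) : (A `<=` B)%classic -> (forall i, 0 <= F i)%E ->
  (\esum_(i in A) F i <= \esum_(i in B) F i)%E.
Proof.
move=> AB F0; rewrite (esum_mkcond A) (esum_mkcond B); apply: le_esum => i _.
case: ifPn => [/set_mem/AB/mem_set ->//|_]; by case: ifP.
Qed.

Section Hardy.
Variable R : realType.
Implicit Types a : nat -> nat -> R[i].

(** The coefficients of the monomial with exponents [j]. *)
Definition delta (j : nat * nat) (m n : nat) : R[i] := ((m, n) == j)%:R.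

Lemma H2_norm2_split a (j : nat * nat) : H2_norm2 a =
  ((sqnorm (a j.1 j.2))%:E +
   \esum_(i in ~` [set j]) (sqnorm (a i.1 i.2))%:E)%E.
Proof.
rewrite /H2_norm2 (esumID [set j]); last first.
  by move=> i _; rewrite lee_fin; exact: sqnorm_ge0.
by rewrite !setTI esum_set1// lee_fin; exact: sqnorm_ge0.
Qed.

Lemma delta_H2 j : in_H2 (delta j).
Proof.
rewrite /in_H2 (H2_norm2_split _ j) esum1 ?adde0 ?ltry// => -[m n] /= /eqP nj.
by rewrite /delta (negbTE nj) /sqnorm mul0r.
Qed.

Lemma Mz_delta m n : Mz (delta (m, n)) = delta (m.+1, n).
Proof. by apply/funext => -[|p]; apply/funext => q. Qed.

Lemma Mw_delta m n : Mw (delta (m, n)) = delta (m, n.+1).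
Proof.
apply/funext => p; apply/funext => -[|q]; rewrite /delta/= !xpair_eqE ?andbF//.
Qed.

(** The shifted array is the [k]-th power of the adjoint of [M_z M_w] applied to [a]. A finite set
    of indices carries all but [d] of the squared norm, and for large [k] the shifted array uses
    only indices outside it. *)
Lemma H2_norm2_tail a (d : R) : in_H2 a -> 0 < d -> exists N, forall k,
  (N <= k)%N -> (H2_norm2 (fun m n => a (m + k)%N (n + k)%N) < d%:E)%E.
Proof.
move=> aH d0; pose f (i : nat * nat) := (sqnorm (a i.1 i.2))%:E.
have f0 i : (0 <= f i)%E by rewrite lee_fin sqnorm_ge0.
have S0 : (0 <= H2_norm2 a)%E by apply: esum_ge0 => i _; exact: f0.
have Sfin : H2_norm2 a \is a fin_num by rewrite ge0_fin_numE.
have [_ [X [finX _] <-] hX] := ub_ereal_sup_adherent d0 Sfin.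
have {}hX : (H2_norm2 a - d%:E < \esum_(i in X) f i)%E.
  by move: hX; rewrite -esum_fset// => i _; exact: f0.
(* First indices are enough: the pair [(m + k, n + k)] has first index at least [k]. *)
have [N XN] : exists N, forall i, X i -> (i.1 < N)%N.
  have [s Xs] := (finite_seqP X).1 finX; exists (\max_(i <- s) i.1).+1 => i.
  by rewrite Xs /= ltnS => si; exact: leq_bigmax_seq.
exists N => k Nk.
have XC : (range (fun i => (i.1 + k, i.2 + k)%N) `<=` ~` X)%classic.
  move=> _ [i _ <-] /XN /=; rewrite ltnNge => /negP; apply.
  exact: leq_trans Nk (leq_addl _ _).
have := subset_esum XC f0; rewrite esum_image; last first.
  by move=> [p q] [p' q'] _ _ [] /addIn -> /addIn ->.
move/le_lt_trans; apply.
have SE : H2_norm2 a = (\esum_(i in X) f i + \esum_(i in ~` X) f i)%E.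
  by rewrite /H2_norm2 (esumID X) ?setTI// => i _; exact: f0.
have Xfin : \esum_(i in X) f i \is a fin_num.
  rewrite ge0_fin_numE; last by apply: esum_ge0 => i _; exact: f0.
  apply: (@le_lt_trans _ _ (H2_norm2 a)) aH.
  by rewrite SE leeDl//; apply: esum_ge0 => i _; exact: f0.
by move: hX; rewrite lteBlDr// SE lteD2lE.
Qed.

End Hardy.

(** * The Hardy pair is 1-finite *)

Section HardyConverse.
Variables (R : realType) (H : lmodType R[i]) (P : hilbert H) (V1 V2 : H -> H).
Hypothesis V12 : isometric_pair P V1 V2.
Variable U : H -> nat -> nat -> R[i].
Hypothesis Ulin : forall (c : R[i]) x y m n,
  U (c *: x + y) m n = c * U x m n + U y m n.
Hypothesis Unorm : forall x, H2_norm2 (U x) = (hnorm P x ^+ 2)%:E.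
Hypothesis Usurj : forall a, in_H2 a -> exists x, U x = a.
Hypothesis UV1 : forall x, U (V1 x) = Mz (U x).
Hypothesis UV2 : forall x, U (V2 x) = Mw (U x).

Let V1i : isometry P V1. Proof. by case: V12. Qed.
Let V2i : isometry P V2. Proof. by case: V12 => _ []. Qed.
Local Notation A1 := (adj P V1).
Local Notation A2 := (adj P V2).

Let UD x y m n : U (x + y) m n = U x m n + U y m n.
Proof. by rewrite -{1}(scale1r x) Ulin mul1r. Qed.

Let U0 m n : U 0 m n = 0.
Proof. by apply: (@addrI _ (U 0 m n)); rewrite -UD !addr0. Qed.

Let UZ c x m n : U (c *: x) m n = c * U x m n.
Proof. by rewrite -[c *: x]addr0 Ulin U0 addr0. Qed.

Let UB x y m n : U (x - y) m n = U x m n - U y m n.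
Proof. by rewrite UD -scaleN1r UZ mulN1r. Qed.

Let U_eq0 x : (forall m n, U x m n = 0) -> x = 0.
Proof.
move=> Ux0; apply: (@rip_eq0 _ _ P); rewrite -hnorm2; apply: EFin_inj.
by rewrite -Unorm /H2_norm2 esum1// => i _; rewrite Ux0 mul0r.
Qed.

Let U_inj x y : (forall m n, U x m n = U y m n) -> x = y.
Proof.
move=> Uxy; apply/eqP; rewrite -subr_eq0; apply/eqP/U_eq0 => m n.
by rewrite UB Uxy subrr.
Qed.

(* Polarization: adding [c delta_j] changes only the [j]-th coefficient. *)
Lemma ip_delta x z j : U z = delta R j -> ip P x z = U x j.1 j.2.
Proof.
move=> Uz; have zj : U z j.1 j.2 = 1 by rewrite Uz /delta -surjective_pairing eqxx.
have split_norm (c : R[i]) y : hnorm P (c *: z + y) ^+ 2 - hnorm P y ^+ 2 =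
    sqnorm (c + U y j.1 j.2) - sqnorm (U y j.1 j.2).
  have tailE : \esum_(i in ~` [set j]) (sqnorm (U (c *: z + y) i.1 i.2))%:E =
      \esum_(i in ~` [set j]) (sqnorm (U y i.1 i.2))%:E.
    apply: eq_esum => i /= /eqP ij; rewrite Ulin Uz /delta -surjective_pairing.
    by rewrite (negbTE ij) mulr0 add0r.
  have := Unorm (c *: z + y); have := Unorm y.
  rewrite !(H2_norm2_split _ j) tailE Ulin zj mulr1.
  (* The common tail is finite because the squared norms are, so it cancels. *)
  case: (esum _ _) => [r| |] //.
  by move=> [<-] [<-]; lra.
have rip_delta y : rip P y z = complex.Re (U y j.1 j.2).
  (* Subtracting the cases [c = 1] and [c = -1] eliminates [rip P z z]. *)
  have := split_norm 1%:C y; have := split_norm (-1)%:C y.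
  rewrite !hnorm2 !ripE !(ripC P z y) /sqnorm.
  by case: (U y j.1 j.2) => a b /=; nra.
rewrite ip_Re_Im !rip_delta UZ; case: (U x _ _) => a b /=.
by rewrite mul0r mul1r sub0r opprK.
Qed.

(** Pair with the vector of the monomial [(m, n)], which [V1] sends to that of [(m.+1, n)]. *)
Let U_adj1 x m n : U (A1 x) m n = U x m.+1 n.
Proof.
have [z Uz] := Usurj (delta_H2 R (m, n)).
rewrite -(ip_delta (A1 x) Uz) adj_isometryP//.
by rewrite (@ip_delta x (V1 z) (m.+1, n))// UV1 Uz Mz_delta.
Qed.

Let U_adj2 x m n : U (A2 x) m n = U x m n.+1.
Proof.
have [z Uz] := Usurj (delta_H2 R (m, n)).
rewrite -(ip_delta (A2 x) Uz) adj_isometryP//.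
by rewrite (@ip_delta x (V2 z) (m, n.+1))// UV2 Uz Mw_delta.
Qed.

Lemma hardy_is_shift : is_shift P (V1 \o V2).
Proof.
move=> x d d0; have d2 : 0 < d ^+ 2 by rewrite exprn_gt0.
have Ux : in_H2 (U x) by rewrite /in_H2 Unorm ltry.
have [N hN] := H2_norm2_tail Ux d2; exists N => k /hN.
rewrite subr0 hnorm_lt// -hnorm2 -lte_fin -Unorm.
suff -> : U (iter k (adj P (V1 \o V2)) x) = fun m n => U x (m + k)%N (n + k)%N.
  by [].
apply/funext => m; apply/funext => n.
elim: k m n => [|k IHk] m n /=; first by rewrite !addn0.
by rewrite adj_comp// U_adj2 U_adj1 IHk !addnS !addSn.
Qed.

Lemma hardy_cross_comm : cross_comm P V1 V2 = fun=> 0.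
Proof.
apply/funext => x; apply: U_eq0 => m n.
by rewrite UB U_adj2 !UV1; case: m => [|m] /=; rewrite ?U_adj2 subrr.
Qed.

(** Inclusion-exclusion: remove the coefficients with [m > 0] and those with [n > 0], restore those
    with both; only the constant term survives. *)
Lemma hardy_defect z x : U z = delta R (0, 0)%N ->
  defect_op P V1 V2 x = U x 0 0 *: z.
Proof.
move=> Uz; apply: U_inj => m n.
rewrite UD !UB UZ Uz UV1 UV1 !UV2 /delta.
case: m n => [|m] [|n] /=; rewrite ?UV2 ?U_adj1 ?U_adj2 /= ?mulr1 ?mulr0;
  by rewrite ?subr0 ?addr0 ?subrr ?sub0r ?addNr.
Qed.

Lemma hardy_one_finite : one_finite_pair P V1 V2.
Proof.
have Z0 : hnorm P 0 = 0 := hnorm0 P.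
split; [split; [split|split]|] => //.
- exact: hardy_is_shift.
- rewrite hardy_cross_comm; split; first split.
  + by move=> a x y; rewrite scaler0 addr0.
  + by exists 0 => x; rewrite Z0 mul0r.
  move=> u _; exists id, 0; split=> // d d0.
  by exists 0%N => n _; rewrite subrr Z0.
- rewrite hardy_cross_comm => x.
  by rewrite (_ : adj P _ = fun=> 0)//; apply: adj_eq => y w; rewrite ip0l ip0r.
(* The constant function [1] spans the range of the defect operator. *)
have [z Uz] := Usurj (delta_H2 R (0, 0)%N).
exists z; split; last split.
- apply: contra_eqN (Uz) => /eqP ->; apply/eqP => /(congr1 (fun f => f 0 0)%N).
  by rewrite U0 /delta eqxx => /eqP; rewrite eq_sym oner_eq0.
- by exists z; rewrite (hardy_defect _ Uz) Uz /delta eqxx scale1r.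
- by move=> x; exists (U x 0 0)%N; exact: hardy_defect.
Qed.

End HardyConverse.

Theorem theorem7p1 (R : realType) (H : lmodType R[i]) (P : hilbert H)
  (V1 V2 : H -> H) :
  isometric_pair P V1 V2 -> irreducible_pair P V1 V2 ->
  (one_finite_pair P V1 V2 <-> unitarily_equiv_Hardy P V1 V2).
Proof.
move=> V12 irr; split; first exact: one_finite_hardy.
by move=> [U [Ulin [Unorm [Usurj [UV1 UV2]]]]]; exact: (hardy_one_finite V12 Ulin).
Qed.
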